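(* Let $d \ge 1$, $n_1,\ldots,n_d \ge 1$ and $s \ge 0$ be integers. For every $X \in \mathbb{C}^{n_1 \times \cdots \times n_d}$, the order-$s$ ANOVA projection of $X$ can be expressed as $$ \Pi_{\le s}(X) = \mathcal{F}^{-1}\big( M_{\le s} \odot \mathcal{F}(X) \big), $$ where $\mathcal{F}$ is the $d$-dimensional discrete Fourier transform on $\mathbb{C}^{n_1 \times \cdots \times n_d}$, $\odot$ is the entrywise product, and the binary mask $M_{\le s} \in \{0,1\}^{n_1 \times \cdots \times n_d}$ has entries given for $\mathbf{i} = (i_1,\ldots,i_d) \in [1:n_1] \times \cdots \times [1:n_d]$ by $$ (M_{\le s})_{\mathbf{i}} = \begin{cases} 1 & \text{if } |\{ j \in [1:d] : i_j \neq 1 \}| \le s, \\ 0 & \text{otherwise.} \end{cases} $$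
   Context: Notation: $[1:n] = \{1,\ldots,n\}$. ANOVA projectors: for $\ell \in [1:d]$, the operator $P_{-\ell}$ averages out the $\ell$-th variable, i.e. $$ (P_{-\ell} X)[i_1,\ldots,i_d] = \frac{1}{n_\ell} \sum_{k=1}^{n_\ell} X[i_1,\ldots,i_{\ell-1},k,i_{\ell+1},\ldots,i_d]. $$ These operators commute with one another, and for $S \subseteq [1:d]$, $$ \Pi_S := \prod_{j \in S} (\mathrm{Id} - P_{-j}) \prod_{\ell \in [1:d] \setminus S} P_{-\ell}, \qquad \Pi_{\le s} := \sum_{S \subseteq [1:d],\ |S| \le s} \Pi_S . $$ Fourier transform convention: for each $j$, let $(\varphi^{(j)}_1,\ldots,\varphi^{(j)}_{n_j})$ be the (unnormalized) Fourier basis of $\mathbb{C}^{n_j}$, i.e. $\varphi^{(j)}_i[k] = e^{2\pi \sqrt{-1}\,(i-1)(k-1)/n_j}$ for $i,k \in [1:n_j]$, so that $\varphi^{(j)}_1$ is the all-one vector. With $\phi_{\mathbf{i}} := \varphi^{(1)}_{i_1} \otimes \cdots \otimes \varphi^{(d)}_{i_d}$, the transform $\mathcal{F}$ produces the discrete Fourier coefficients of $X$, i.e. $\mathcal{F}(X)$ is the unique tensor such that $X = \sum_{\mathbf{i}} \mathcal{F}(X)_{\mathbf{i}} \, \phi_{\mathbf{i}}$, and $\mathcal{F}^{-1}(Z) = \sum_{\mathbf{i}} Z_{\mathbf{i}}\, \phi_{\mathbf{i}}$. *)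

(* Defs.v *)
From HB Require Import structures.
From mathcomp Require Import all_boot all_order all_algebra.
From mathcomp Require Import boolp classical_sets reals trigo.
From mathcomp Require Export complex.
Set Implicit Arguments.
Unset Strict Implicit.
Unset Printing Implicit Defensive.
Import GRing.Theory.
Local Open Scope ring_scope.

(* Indices are 0-based: [1:d] and [1:n_j] become 'I_d and 'I_(n j), so the
   shifts (i-1)(k-1) in the Fourier exponent disappear and the condition
   i_j <> 1 in the mask becomes i j != 0. *)
Section Anova.
Variables (R : realType) (d : nat) (n : 'I_d -> nat).

Definition multi_index := {dffun forall j : 'I_d, 'I_(n j)}.
Definition tensor := {ffun multi_index -> R[i]}.

Definition set_coord (i : multi_index) (l : 'I_d) (k : 'I_(n l)) : multi_index :=
  finfun (dfwith i k).

Definition avg (l : 'I_d) (X : tensor) : tensor :=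
  [ffun i => ((n l)%:R)^-1 * \sum_(k < n l) X (set_coord i k)].

(* The product of operators is composition; since the operators involved
   commute, the (increasing) order used by the big operator is immaterial. *)
Definition anova_proj (S : {set 'I_d}) : tensor -> tensor :=
  (\big[comp/idfun]_(j in S) (fun X : tensor => X - avg j X))
  \o (\big[comp/idfun]_(l in ~: S) avg l).

Definition anova_proj_le (s : nat) (X : tensor) : tensor :=
  \sum_(S : {set 'I_d} | (#|S| <= s)%N) anova_proj S X.

Definition expi (t : R) : R[i] := (cos t +i* sin t)%C.

Definition fourier (m : nat) (i k : 'I_m) : R[i] :=
  expi (2 * pi * i%:R * k%:R / m%:R).

Definition fourier_tensor (i : multi_index) : tensor :=
  [ffun k : multi_index => \prod_(j < d) fourier (i j) (k j)].

Definition idft (Z : tensor) : tensor :=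
  [ffun k => \sum_(i : multi_index) Z i * fourier_tensor i k].

(* The tensor Z such that X = \sum_i Z_i phi_i, by definite description
   (such a Z exists and is unique as the phi_i form a basis; the default 0 is
   never used). *)
Definition dft (X : tensor) : tensor := xget 0 [set Z | X = idft Z]%classic.

Definition hadamard (X Y : tensor) : tensor := [ffun i => X i * Y i].

Definition anova_mask (s : nat) : tensor :=
  [ffun i : multi_index =>
    if (#|[set j : 'I_d | (i j != 0 :> nat)]%SET| <= s)%N then 1 else 0].

End Anova.

(* Main.v *)
(** The Fourier tensors [phi_i] diagonalise every [P_{-l}], with eigenvalue
    [1] if [i_l] is the zero frequency and [0] otherwise, because the other
    one-dimensional characters have mean zero.  Hence [Pi_S phi_i] is [phi_i]
    when [S] is the set of nonzero coordinates of [i] and [0] otherwise, and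
    summing over [|S| <= s] yields the mask. *)
Require Import Defs.
From mathcomp Require Import all_boot all_order all_algebra reals.
From mathcomp Require Import boolp classical_sets trigo.
From mathcomp Require Import ring.
Set Implicit Arguments.
Unset Strict Implicit.
Unset Printing Implicit Defensive.
Import Order.TTheory GRing.Theory Num.Theory.
Local Open Scope ring_scope.

(** For [z != 1], multiplying by [z - 1] telescopes the geometric sum to [z ^+ m - 1 = 0]. *)
Lemma sum_expr_root_of_unity (F : fieldType) (m : nat) (z : F) :
  z ^+ m = 1 -> \sum_(a < m) z ^+ a = if z == 1 then m%:R else 0.
Proof.
move=> zm1; case: eqP => [->|/eqP z_neq1].
  under eq_bigr do rewrite expr1n.
  by rewrite sumr_const card_ord.
apply: (mulfI (x := z - 1)); first by rewrite subr_eq0.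
by rewrite -subrX1 zm1 subrr mulr0.
Qed.

Lemma prod_sum_dffun (K : comNzRingType) (I : finType) (T : I -> finType)
    (F : forall i, T i -> K) :
  \prod_i \sum_(k : T i) F i k =
  \sum_(t : {dffun forall i, T i}) \prod_i F i (t i).
Proof.
pose P i : {ffun T i -> K} := [ffun k => F i k].
transitivity (\prod_i \sum_(k : T i) P i k).
  by apply: eq_bigr => i _; apply: eq_bigr => k _; rewrite ffunE.
(* The summation types [T i] vary with [i]; tagging moves all the sums into one type, where the
   distributivity law applies, and the well-tagged families are then read back as dependent
   functions. *)
under eq_bigr do rewrite (big_tag P).
rewrite bigA_distr_big_dep -big_fprod.
rewrite [RHS](reindex (@dffun_of_fprod I T)) /=; last exact/onW_bij/dffun_of_fprod_bij.
by apply: eq_bigr => t _; apply: eq_bigr => i _; rewrite !ffunE.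
Qed.

Section Fourier1.
Variable R : realType.

Lemma expiD (a b : R) : expi (a + b) = expi a * expi b.
Proof. by rewrite /expi cosD sinD; congr Complex; rewrite addrC. Qed.

Lemma expi0 : expi (0 : R) = 1.
Proof. by rewrite /expi cos0 sin0. Qed.

Lemma expiMn (a : R) k : expi (a *+ k) = expi a ^+ k.
Proof.
by elim: k => [|k IHk]; rewrite ?mulr0n ?expi0// mulrS expiD IHk exprS.
Qed.

(** The real part is [1 - 2 sin(t/2)^2], and [sin (t / 2)] is positive because [t / 2] lies strictly
    between [0] and [pi]. *)
Lemma expi_neq1 (t : R) : 0 < t < pi *+ 2 -> expi t != 1.
Proof.
move=> /andP[t_gt0 t_lt]; rewrite /expi eq_complex /=; apply/nandP; left.
have st : 0 < sin (t / 2).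
  by apply: sin_gt0_pi; rewrite divr_gt0//= ltr_pdivrMr// mulr_natr.
have -> : t = (t / 2) *+ 2 by rewrite mulr2n -splitr.
rewrite cos_mulr2n cos2sin2 -subr_eq0.
have -> : (1 - sin (t / 2) ^+ 2) *+ 2 - 1 - 1 = - (sin (t / 2) ^+ 2 *+ 2) by ring.
by rewrite oppr_eq0 mulrn_eq0 /= expf_eq0 /= gt_eqF.
Qed.

Definition root1 (m : nat) : R[i] := expi (pi *+ 2 / m%:R).

(** The order [k] divides [m]; were it smaller than [m], the angle [2 pi k / m] would lie strictly
    between [0] and [2 pi], contradicting [expi_neq1]. *)
Lemma root1_prim (m : nat) : (0 < m)%N -> m.-primitive_root (root1 m).
Proof.
move=> m_gt0; have m_neq0 : m%:R != 0 :> R by rewrite pnatr_eq0 -lt0n.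
have wm1 : root1 m ^+ m = 1.
  by rewrite -expiMn -[X in expi X]mulr_natr divfK// /expi cos2pi sin2pi.
have [k kprim kdvd] := prim_order_exists m_gt0 wm1.
suff /eqP km : k == m by rewrite -[X in X.-primitive_root _]km.
have k_gt0 := prim_order_gt0 kprim.
rewrite eqn_leq (dvdn_leq m_gt0 kdvd) leqNgt; apply/negP => k_lt.
have /negP[] : root1 m ^+ k != 1.
  rewrite -expiMn; apply: expi_neq1.
  have pi2 : 0 < pi *+ 2 :> R by rewrite pmulrn_lgt0// pi_gt0.
  rewrite pmulrn_lgt0// divr_gt0 ?ltr0n//=.
  by rewrite -[X in X < _]mulr_natr mulrAC ltr_pdivrMr ?ltr0n// ltr_pM2l// ltr_nat.
by rewrite (prim_expr_order kprim).
Qed.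

Lemma fourierE (m : nat) (i k : 'I_m) : fourier R i k = root1 m ^+ (i * k).
Proof.
by rewrite -expiMn /fourier -[X in _ = expi X]mulr_natr natrM; congr expi; ring.
Qed.

Lemma sum_fourier (m : nat) (i : 'I_m) :
  \sum_(k < m) fourier R i k = if i == 0 :> nat then m%:R else 0.
Proof.
have m_gt0 : (0 < m)%N by apply: leq_ltn_trans (ltn_ord i).
have wprim := root1_prim m_gt0.
under eq_bigr do rewrite fourierE exprM.
rewrite sum_expr_root_of_unity; last first.
  by rewrite exprAC (prim_expr_order wprim) expr1n.
by rewrite -(prim_order_dvd wprim) /dvdn modn_small.
Qed.

(** The sum runs over frequencies, as inverting [idft] requires: it is geometric, with ratio
    [z = w^(k - l)] for the primitive root [w], and [z = 1] only if [k = l] since both are below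
    [m]. *)
Lemma fourier_orthogonality (m : nat) (k l : 'I_m) :
  \sum_(a < m) (fourier R a l)^-1 * fourier R a k = if l == k then m%:R else 0.
Proof.
have m_gt0 : (0 < m)%N by apply: leq_ltn_trans (ltn_ord k).
have wprim := root1_prim m_gt0.
have w_neq0 : root1 m != 0 by rewrite (prim_root_eq0 wprim) -lt0n.
pose z := (root1 m ^+ l)^-1 * root1 m ^+ k.
under eq_bigr => a _.
  rewrite !fourierE mulnC exprM (mulnC a k) exprM -exprVn -exprMn -/z; over.
rewrite sum_expr_root_of_unity; last first.
  by rewrite exprMn exprVn ![(_ ^+ _) ^+ m]exprAC (prim_expr_order wprim) !expr1n invr1 mulr1.
congr (if _ then _ else _).
rewrite /z mulrC -subr_eq0 -(mulfV (expf_neq0 l w_neq0)) -mulrBl mulf_eq0.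
rewrite invr_eq0 (negPf (expf_neq0 l w_neq0)) orbF subr_eq0.
by rewrite (eq_prim_root_expr wprim) !modn_small// eq_sym.
Qed.

End Fourier1.

Section Diagonalisation.
Variables (R : realType) (d : nat) (n : 'I_d -> nat).
Hypothesis n_gt0 : forall j, (0 < n j)%N.
Implicit Types (X Z : tensor R n) (i k : multi_index n) (S : {set 'I_d}).

Let natr_n_neq0 j : (n j)%:R != 0 :> R[i].
Proof. by rewrite pnatr_eq0 -lt0n. Qed.

(** This rules out the default value in [dft], whence [dftK]. The witness is the usual inversion
    formula, with conjugate characters written as inverses. *)
Lemma idft_surj X : exists Z, X = idft Z.
Proof.
pose N : R[i] := \prod_j (n j)%:R.
have N_neq0 : N != 0 by apply/prodf_neq0.
exists [ffun i : multi_index n =>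
  N^-1 * \sum_l X l * \prod_j (fourier R (i j) (l j))^-1].
apply/ffunP => k; rewrite ffunE.
under eq_bigr => i _.
  rewrite !ffunE -mulrA mulr_suml.
  under eq_bigr do rewrite -mulrA -big_split /=.
  over.
rewrite -mulr_sumr exchange_big /=.
(* The sum over all frequencies factors into one orthogonality sum per coordinate. *)
under eq_bigr => l _.
  rewrite -mulr_sumr -(prod_sum_dffun
    (fun j a => (fourier R a (l j))^-1 * fourier R a (k j))).
  under eq_bigr do rewrite fourier_orthogonality.
  over.
rewrite (bigD1 k)//= [X in _ + X]big1 => [|l l_neqk].
  under eq_bigr do rewrite eqxx.
  by rewrite addr0 -/N mulrCA mulVf// mulr1.
(* Off the diagonal, a single differing coordinate contributes a zero factor. *)
have [j ljk] : exists j, l j != k j.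
  apply/existsP; rewrite -negb_forall; apply: contraNN l_neqk => /forallP lk.
  by apply/eqP; apply/ffunP => j; exact/eqP/lk.
by rewrite (bigD1 j)//= (negPf ljk) mul0r mulr0.
Qed.

Lemma dftK X : idft (dft X) = X.
Proof. exact/esym/(xgetPex 0 (idft_surj X)). Qed.

Lemma sum_fourier_tensor_set_coord i k (l : 'I_d) :
  (n l)%:R^-1 * \sum_(a < n l) fourier_tensor R i (set_coord k a) =
  if i l == 0 :> nat then fourier_tensor R i k else 0.
Proof.
under eq_bigr => a _.
  rewrite ffunE (bigD1 l)//= ffunE dfwith_in.
  under eq_bigr => j j_neql do rewrite ffunE dfwith_out 1?eq_sym//.
  over.
rewrite -mulr_suml sum_fourier; case: ifP => [/eqP il0|_]; last by rewrite mul0r mulr0.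
by rewrite mulKf// ffunE [RHS](bigD1 l)//= fourierE il0 mul0n expr0 mul1r.
Qed.

Lemma avg_idft (l : 'I_d) Z :
  avg l (idft Z) = idft [ffun i : multi_index n => (i l == 0 :> nat)%:R * Z i].
Proof.
apply/ffunP => k; rewrite !ffunE.
under eq_bigr do rewrite ffunE.
rewrite exchange_big mulr_sumr; apply: eq_bigr => i _ /=.
rewrite -mulr_sumr mulrCA sum_fourier_tensor_set_coord !ffunE.
by case: ifP; rewrite ?mul1r ?mul0r ?mulr0.
Qed.

Lemma sub_avg_idft (l : 'I_d) Z :
  idft Z - avg l (idft Z) = idft [ffun i : multi_index n => (i l != 0 :> nat)%:R * Z i].
Proof.
rewrite avg_idft; apply/ffunP => k; rewrite !ffunE -sumrB.
apply: eq_bigr => i _; rewrite !ffunE -mulrBl.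
by case: eqP => _ /=; rewrite !(mul1r, subrr, mul0r, subr0).
Qed.

(** Composing diagonal operators multiplies their eigenvalues; these are 0 or 1, so the product is a
    conjunction. *)
Lemma comp_idft (P : pred 'I_d) (f : 'I_d -> tensor R n -> tensor R n)
    (c : 'I_d -> multi_index n -> bool) Z :
  (forall j Y, f j (idft Y) = idft [ffun i : multi_index n => (c j i)%:R * Y i]) ->
  (\big[comp/idfun]_(j | P j) f j) (idft Z) =
  idft [ffun i : multi_index n => [forall (j | P j), c j i]%:R * Z i].
Proof.
move=> f_diag.
have -> : (\big[comp/idfun]_(j | P j) f j) (idft Z) =
    idft [ffun i : multi_index n => (\big[andb/true]_(j | P j) c j i)%:R * Z i].
  elim: (index_enum _) => [|j r IHr].
    rewrite big_nil /=; congr idft; apply/ffunP => i.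
    by rewrite ffunE big_nil mul1r.
  rewrite big_cons; case: ifP => Pj /=; rewrite IHr ?f_diag; congr idft.
    apply/ffunP => i.
    by rewrite !ffunE big_cons Pj mulrA -natrM mulnb.
  by apply/ffunP => i; rewrite !ffunE big_cons Pj.
by congr idft; apply/ffunP => i; rewrite !ffunE big_andE.
Qed.

Definition freq_support i : {set 'I_d} := [set j | i j != 0 :> nat].

Lemma anova_proj_idft S Z :
  anova_proj S (idft Z) = idft [ffun i : multi_index n => (S == freq_support i)%:R * Z i].
Proof.
rewrite /anova_proj /= (comp_idft _ _ avg_idft) (comp_idft _ _ sub_avg_idft).
congr idft; apply/ffunP => i; rewrite !ffunE mulrA -natrM mulnb.
(* The factors [Id - P_{-j}] for [j] in [S] force [S] inside the support of [i]; the averages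
   outside [S] force the reverse inclusion. *)
congr (_%:R * _); congr nat_of_bool; rewrite finset.eqEsubset; congr andb.
  by apply/forall_inP/fintype.subsetP => Si j jS; have := Si j jS; rewrite inE.
apply/forall_inP/fintype.subsetP => Si j.
  by rewrite inE; apply: contraNT => jS; apply: Si; rewrite inE.
by rewrite inE; apply: contraNT => ij0; apply: Si; rewrite inE.
Qed.

Lemma anova_proj_le_idft s Z :
  anova_proj_le s (idft Z) = idft (hadamard (anova_mask R n s) Z).
Proof.
apply/ffunP => k; rewrite /anova_proj_le sum_ffunE ffunE.
under eq_bigr do rewrite anova_proj_idft ffunE.
rewrite exchange_big; apply: eq_bigr => i _ /=.
under eq_bigr do rewrite ffunE.
rewrite -!mulr_suml !ffunE -/(freq_support i); congr (_ * _ * _).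
(* Only [S = freq_support i] can contribute, and it occurs in the sum exactly when its cardinality
   is at most [s]. *)
rewrite -natr_sum; case: ifP => i_le.
  by rewrite (bigD1 (freq_support i))//= eqxx big1 ?addn0// => S /andP[_ /negPf ->].
by rewrite big1// => S S_le; case: eqP => // Si; rewrite Si i_le in S_le.
Qed.

End Diagonalisation.

Theorem corollary5 (R : realType) (d : nat) (n : 'I_d -> nat) (s : nat)
    (d_ge1 : (1 <= d)%N) (n_ge1 : forall j : 'I_d, (1 <= n j)%N)
    (X : tensor R n) :
  anova_proj_le s X = idft (hadamard (anova_mask R n s) (dft X)).
Proof. by rewrite -(anova_proj_le_idft n_ge1) dftK. Qed.
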